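(* The merge rule and the d-shortcut rule are complete for acyclic free choice colored workflow nets. That is, for every sound, acyclic, free choice CWF net $\mathcal{W}$ there is a finite sequence of applications of the merge rule and the d-shortcut rule transforming $\mathcal{W}$ into a CWF net whose only places are $i$ and $o$ and which has exactly one transition, with input place $i$ and output place $o$.
   Context: A workflow net (WF net) is a tuple $(P,T,F,i,o)$ with the following components: - $P$ and $T$ are finite disjoint sets of places and transitions. - $F\subseteq (P\times T)\cup(T\times P)$ is a set of arcs. - $i$ has no incoming arcs and $o$ has no outgoing arcs. - The graph $(P\cup T,F\cup\{(o,i)\})$ is strongly connected. ${}^\bullet x$ and $x^\bullet$ denote the input and output nodes of $x$. A marking is $M:P\to\mathbb{N}$. A transition $t$ is enabled if every place of ${}^\bullet t$ has a token; firing $t$ removes one token from each place of ${}^\bullet t$ and adds one to each place of $t^\bullet$. The initial (final) marking has exactly one token, on $i$ (on $o$). A WF net is sound if the final marking is reachable from every marking reachable from the initial marking, and every transition occurs in some firing sequence from the initial marking. It is free choice if for all places $p_1,p_2$ either $p_1^\bullet\cap p_2^\bullet=\emptyset$ or $p_1^\bullet=p_2^\bullet$. It is acyclic if the graph $(P\cup T,F)$ is acyclic. The cluster $[x]$ of a node $x$ is the smallest set containing $x$ that contains $p^\bullet$ for each place $p$ in it and ${}^\bullet t$ for each transition $t$ in it. A cluster $c$ is free choice if $(p,t)\in F$ for all places $p\in c$ and transitions $t\in c$. A colored WF net (CWF net) adds to a WF net a color set $C_p$ for each place and, for each transition $t$, a left-total relation $\lambda(t)\subseteq\prod_{p\in{}^\bullet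 t}C_p\times\prod_{p\in t^\bullet}C_p$. Soundness, free choice and acyclicity of a CWF net refer to its underlying WF net. Merge rule. If distinct transitions $t_1,t_2$ have ${}^\bullet t_1={}^\bullet t_2$ and $t_1^\bullet=t_2^\bullet$, replace them by one fresh transition with the same input and output places and transformer $\lambda(t_1)\cup\lambda(t_2)$. Shortcut rule. A transition $t$ unconditionally enables a cluster $c$ if all places of $c$ lie in $t^\bullet$. If $t$ unconditionally enables a free choice cluster $c\notin\{[o],[t]\}$: 1. Remove $t$. 2. For each transition $t'\in c$, add a fresh transition $t'_s$ with ${}^\bullet t'_s={}^\bullet t$, $t'^\bullet_s=(t^\bullet\setminus{}^\bullet t')\cup t'^\bullet$, and $\lambda(t'_s)$ the sequential composition of $\lambda(t)$ followed by $\lambda(t')$. 3. If afterwards no place of $c$ has an input transition, remove $c$. The d-shortcut rule is the shortcut rule with the additional guard that $c$ contains exactly one transition. *)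

(* Defs.v *)
From mathcomp Require Import ssreflect ssrfun ssrbool eqtype ssrnat seq.

Set Implicit Arguments.
Unset Strict Implicit.
Unset Printing Implicit Defensive.

(* Places and transitions are named by natural numbers (two separate name   *)
(* spaces, hence disjoint).  The finite sets P and T are given by sequences *)
(* read as sets (only membership matters).  The colour set of place p is    *)
(* [col p]; the colour assignment [col] is a parameter shared by a net and  *)
(* all nets obtained from it by the reduction rules (rules never change the *)
(* colour set of a surviving place).                                        *)

Definition asg (col : nat -> Type) (s : seq nat) : Type :=
  forall p : nat, p \in s -> col p.

Record trans (col : nat -> Type) := Trans {
  tpre  : seq nat;
  tpost : seq nat;
  trel  : asg col tpre -> asg col tpost -> Prop
}.

Record net (col : nat -> Type) := Net {
  pl : seq nat;
  tr : seq nat;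
  td : nat -> trans col;     (* data of each transition (relevant on T) *)
  pi : nat;
  po : nat
}.

Section Nets.
Variable col : nat -> Type.
Implicit Types N : net col.

Definition pre N t := tpre (td N t).
Definition post N t := tpost (td N t).

Definition node := (nat + nat)%type.

Definition in_net N (x : node) : Prop :=
  match x with inl p => p \in pl N | inr t => t \in tr N end.

Definition arcF N (x y : node) : Prop :=
  match x, y with
  | inl p, inr t => [/\ p \in pl N, t \in tr N & p \in pre N t]
  | inr t, inl p => [/\ t \in tr N, p \in pl N & p \in post N t]
  | _, _ => False
  end.

Inductive star (A : Type) (R : A -> A -> Prop) : A -> A -> Prop :=
| star_refl x : star R x x
| star_step x y z : R x y -> star R y z -> star R x z.

Definition plus (A : Type) (R : A -> A -> Prop) (x y : A) : Prop :=
  exists2 z, R x z & star R z y.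

Definition is_wf N : Prop :=
  [/\ [/\ pi N \in pl N, po N \in pl N & pi N != po N],
      (forall t, t \in tr N ->
         {subset pre N t <= pl N} /\ {subset post N t <= pl N}),
      (forall t, t \in tr N -> pi N \notin post N t),
      (forall t, t \in tr N -> po N \notin pre N t) &
      (forall x y, in_net N x -> in_net N y ->
         star (fun u v => arcF N u v \/ (u = inl (po N) /\ v = inl (pi N))) x y)].

Definition is_cwf N : Prop :=
  is_wf N /\
  forall t, t \in tr N -> forall a : asg col (pre N t),
    exists b : asg col (post N t), @trel col (td N t) a b.

Definition marking := nat -> nat.

Definition enabled N (t : nat) (M : marking) : Prop :=
  t \in tr N /\ forall p, p \in pre N t -> 0 < M p.

Definition fire N (t : nat) (M : marking) : marking :=
  fun p => M p - (p \in pre N t) + (p \in post N t).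

Definition mstep N (M M' : marking) : Prop :=
  exists2 t, enabled N t M & M' = fire N t M.

Definition init_marking N : marking := fun p => nat_of_bool (p == pi N).
Definition final_marking N : marking := fun p => nat_of_bool (p == po N).

Definition sound N : Prop :=
  (forall M, star (mstep N) (init_marking N) M ->
     exists2 M', star (mstep N) M M' &
       forall p, p \in pl N -> M' p = final_marking N p) /\
  (forall t, t \in tr N ->
     exists2 M, star (mstep N) (init_marking N) M & enabled N t M).

Definition free_choice N : Prop :=
  forall p1 p2, p1 \in pl N -> p2 \in pl N ->
    (forall t, t \in tr N -> ~ (p1 \in pre N t /\ p2 \in pre N t)) \/
    (forall t, t \in tr N -> (p1 \in pre N t <-> p2 \in pre N t)).

Definition acyclic N : Prop := forall x, ~ plus (arcF N) x x.

Inductive clus N (x : node) : node -> Prop :=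
| clus_self : clus N x x
| clus_pt p t : clus N x (inl p) -> p \in pl N -> t \in tr N ->
    p \in pre N t -> clus N x (inr t)
| clus_tp t p : clus N x (inr t) -> t \in tr N -> p \in pl N ->
    p \in pre N t -> clus N x (inl p).

Definition same_cluster N (x y : node) : Prop :=
  forall z, clus N x z <-> clus N y z.

Definition fc_cluster N (x : node) : Prop :=
  forall p t, clus N x (inl p) -> clus N x (inr t) -> arcF N (inl p) (inr t).

Definition uncond_enables N (t : nat) (x : node) : Prop :=
  forall p, clus N x (inl p) -> p \in post N t.

Definition agree (s1 s2 : seq nat) (a1 : asg col s1) (a2 : asg col s2) : Prop :=
  forall p (h1 : p \in s1) (h2 : p \in s2), a1 p h1 = a2 p h2.

Definition merge_trans (d1 d2 : trans col) : trans col :=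
  @Trans col (tpre d1) (tpost d1)
    (fun a b => @trel col d1 a b \/
       exists (a2 : asg col (tpre d2)) (b2 : asg col (tpost d2)),
         [/\ @trel col d2 a2 b2, agree a a2 & agree b b2]).

Definition merge_step N N' : Prop :=
  exists t1 t2 tn,
  [/\ [/\ t1 \in tr N, t2 \in tr N & t1 != t2],
      pre N t1 =i pre N t2, post N t1 =i post N t2,
      tn \notin tr N &
      [/\ [/\ pl N' =i pl N, pi N' = pi N & po N' = po N],
          tr N' =i [:: tn & [seq u <- tr N | (u != t1) && (u != t2)]],
          td N' tn = merge_trans (td N t1) (td N t2) &
          (forall u, u \in tr N' -> u != tn -> td N' u = td N u)]].

(* Sequential composition of lambda(t) followed by lambda(t'), the new       *)
(* transition having input •t and output (t• \ •t') ∪ t'•.  On a place of    *)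
(* t'• the output colour is the one produced by t'; on the other output      *)
(* places it is the one produced by t.                                       *)
Definition shortcut_trans (d d' : trans col) : trans col :=
  @Trans col (tpre d) ([seq p <- tpost d | p \notin tpre d'] ++ tpost d')
    (fun a b =>
       exists (m : asg col (tpost d)) (a' : asg col (tpre d'))
              (n : asg col (tpost d')),
         [/\ @trel col d a m, agree a' m, @trel col d' a' n, agree b n &
             (forall p (hb : p \in [seq p <- tpost d | p \notin tpre d'] ++ tpost d')
                      (hm : p \in tpost d),
               p \notin tpost d' -> b p hb = m p hm)]).

Definition dshortcut_step N N' : Prop :=
  exists (t : nat) (x : node) (t' ts : nat),
  [/\ [/\ t \in tr N, in_net N x, fc_cluster N x & uncond_enables N t x],
      ~ same_cluster N x (inl (po N)) /\ ~ same_cluster N x (inr t),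
      [/\ t' \in tr N, clus N x (inr t') &
          (forall u, u \in tr N -> clus N x (inr u) -> u = t')],
      ts \notin tr N &
      let tr1 u := (u == ts) || ((u \in tr N) && (u != t)) in
      let post1 u := if u == ts then
                       [seq p <- post N t | p \notin pre N t'] ++ post N t'
                     else post N u in
      let removed := forall p, clus N x (inl p) ->
                     forall u, tr1 u -> p \notin post1 u in
      [/\ pi N' = pi N /\ po N' = po N,
          (forall p, p \in pl N' <->
            p \in pl N /\ ~ (removed /\ clus N x (inl p))),
          (forall u, u \in tr N' <->
            tr1 u /\ ~ (removed /\ clus N x (inr u))),
          td N' ts = shortcut_trans (td N t) (td N t') &
          (forall u, u \in tr N' -> u != ts -> td N' u = td N u)]].

Definition rule_step N N' : Prop := merge_step N N' \/ dshortcut_step N N'.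

End Nets.

(* Main.v *)
(* Along every transition a rank of the places strictly decreases, so runs
   terminate, and soundness says that dead reachable markings are final.  In a
   sound acyclic free choice net two tokens never lie on a common path to [po].

   An irreducible net is trivial: choose a reachable marking enabling two
   conflicting transitions t1, t2 such that no conflict can arise later.  If
   neither t1 nor t2 admits a d-shortcut, then after firing either of them every
   transition is fed by the descendants of the tokens that were left over, and
   t1, t2 have the same outputs, hence can be merged.  Without reachable
   conflicts the same argument applied to the initial marking shows that the
   first transition leads from [pi] to [po].

   Both rules preserve soundness and lower the sum over all transitions of
   (1 + weight of the outputs), where the weight of a place is exponential in
   its rank. *)

Require Import Defs.
From mathcomp Require Import ssreflect ssrfun ssrbool eqtype ssrnat seq.
From mathcomp Require Import bigop zify boolp.

Set Implicit Arguments.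
Unset Strict Implicit.
Unset Printing Implicit Defensive.

(** * Reflexive transitive closures *)

Lemma star_trans (A : Type) (R : A -> A -> Prop) x y z :
  star R x y -> star R y z -> star R x z.
Proof. by elim=> // a b c Rab _ IH /IH; apply: star_step. Qed.

Lemma star_rcons (A : Type) (R : A -> A -> Prop) x y z :
  star R x y -> R y z -> star R x z.
Proof. by move=> xy yz; apply: star_trans xy _; apply: star_step yz (star_refl _ _). Qed.

Lemma star_invariant (A : Type) (R : A -> A -> Prop) (P : A -> Prop) x y :
  (forall a b, P a -> R a b -> P b) -> P x -> star R x y -> P y.
Proof. by move=> PR + xy; elim: xy => // a b c Rab _ IH /PR/(_ Rab). Qed.

Lemma star_last (A : Type) (R : A -> A -> Prop) x y :
  star R x y -> x = y \/ exists2 z, star R x z & R z y.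
Proof.
elim=> [a|a b c Rab bc [<-|[z bz Rzc]]]; first by left.
- by right; exists a => //; apply: star_refl.
- by right; exists z => //; apply: star_step Rab bz.
Qed.

Lemma star_first (A : Type) (R : A -> A -> Prop) x y :
  star R x y -> x = y \/ exists2 z, R x z & star R z y.
Proof. by case=> [a|a b c Rab bc]; [left|right; exists b]. Qed.

(** * Ranked nets, weights and termination of runs *)

Section Ranked.

Variables (col : nat -> Type) (rk : nat -> nat) (Pl : seq nat).
Implicit Types (N : net col) (M : marking) (t u p q : nat) (s : seq nat).

Definition pstep N p q : Prop :=
  exists t, [/\ t \in tr N, p \in pre N t & q \in post N t].

Definition reachable N M : Prop := star (mstep N) (init_marking N) M.

Definition dead N M : Prop := forall t, ~ enabled N t M.

(* On acyclic nets this replaces [is_wf]: strong connectedness amounts to the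
   nonemptiness conditions of [ranked] and [good]. *)
Record ranked N : Prop := Ranked {
  pi_pl : pi N \in pl N;
  po_pl : po N \in pl N;
  pi_neq_po : pi N != po N;
  pl_sub : {subset pl N <= Pl};
  pre_sub : forall t, t \in tr N -> {subset pre N t <= pl N};
  post_sub : forall t, t \in tr N -> {subset post N t <= pl N};
  pi_post : forall t, t \in tr N -> pi N \notin post N t;
  po_pre : forall t, t \in tr N -> po N \notin pre N t;
  pre_ex : forall t, t \in tr N -> exists p, p \in pre N t;
  post_ex : forall t, t \in tr N -> exists p, p \in post N t;
  out_ex : forall p, p \in pl N -> p != po N ->
    exists2 t, t \in tr N & p \in pre N t;
  rk_lt : forall t p q, t \in tr N -> p \in pre N t -> q \in post N t ->
    rk q < rk p;
  same_pre : forall t u p, t \in tr N -> u \in tr N ->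
    p \in pre N t -> p \in pre N u -> pre N t =i pre N u;
  total : forall t, t \in tr N -> forall a : asg col (pre N t),
    exists b : asg col (post N t), @trel col (td N t) a b }.

Record good N : Prop := Good {
  good_ranked :> ranked N;
  in_ex : forall p, p \in pl N -> p != pi N ->
    exists2 t, t \in tr N & p \in post N t;
  dead_final : forall M, reachable N M -> dead N M ->
    forall p, p \in pl N -> M p = final_marking N p;
  live : forall t, t \in tr N -> exists2 M, reachable N M & enabled N t M }.

(* The base exceeds the number of places, so that one input token outweighs all
   the output tokens of a transition. *)
Definition pw p := (size Pl).+1 ^ rk p.
Definition wt s := \sum_(p <- Pl | p \in s) pw p.
Definition mwt M := \sum_(p <- Pl) M p * pw p.

Lemma wt_post_lt_pre N t : ranked N -> t \in tr N -> wt (post N t) < wt (pre N t).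
Proof.
move=> rN tN; have [p pt] := pre_ex rN tN.
have pPl : p \in Pl by apply: (pl_sub rN); apply: (pre_sub rN tN).
apply: (@leq_trans (pw p)); last first.
  by rewrite /wt (big_rem p) //= pt leq_addr.
have rkp0 : forall q, q \in post N t -> pw q <= (size Pl).+1 ^ (rk p).-1.
  move=> q qt; have := rk_lt rN tN pt qt => lt; apply: leq_pexp2l => //; lia.
have [q0 q0t] := post_ex rN tN.
(* Since [t] has an output, [rk p] is positive and [(rk p).-1] is a true predecessor. *)
have rkp : rk p = (rk p).-1.+1 by have := rk_lt rN tN pt q0t; lia.
rewrite /pw rkp expnS.
apply: (@leq_ltn_trans (size Pl * (size Pl).+1 ^ (rk p).-1)); last first.
  by rewrite ltn_pmul2r ?expn_gt0.
rewrite /wt; apply: leq_trans (leq_sum _ _) _ => /=; first by exact: rkp0.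
by rewrite big_const_seq iter_addn_0 mulnC leq_mul2r count_size orbT.
Qed.

Lemma wtE s : wt s = \sum_(p <- Pl) (p \in s) * pw p.
Proof. by rewrite /wt big_mkcond; apply: eq_bigr => p _; case: ifP; rewrite ?mul1n. Qed.

Lemma mwt_fire N t M : ranked N -> enabled N t M -> mwt (fire N t M) < mwt M.
Proof.
move=> rN [tN tM]; have := wt_post_lt_pre rN tN.
(* The balance of tokens is stated additively to avoid truncated subtraction. *)
suff : mwt (fire N t M) + wt (pre N t) = mwt M + wt (post N t) by lia.
rewrite !wtE /mwt -!big_split /=; apply: eq_bigr => p _.
have Mp : (p \in pre N t) <= M p by case: (boolP (p \in _)) => // /tM.
by rewrite /fire -!mulnDl addnAC subnK.
Qed.

Lemma enabled_same_pre N t u p M : ranked N -> enabled N t M -> u \in tr N ->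
  p \in pre N t -> p \in pre N u -> enabled N u M.
Proof.
move=> rN [tN tM] uN pt pu; split=> // q.
by rewrite -(same_pre rN tN uN pt pu); apply: tM.
Qed.

Lemma fire_post N t M p : p \in post N t -> 0 < fire N t M p.
Proof. by rewrite /fire => ->; lia. Qed.

Lemma fire_keep N t M p : p \notin pre N t -> M p <= fire N t M p.
Proof. by rewrite /fire => /negbTE->; lia. Qed.

Lemma reach_dead N M : ranked N ->
  exists2 M', star (mstep N) M M' & dead N M'.
Proof.
move=> rN; have [n] := ubnP (mwt M); elim: n M => // n IH M ltn.
case: (EM (dead N M)) => [dM|]; first by exists M => //; apply: star_refl.
move=> /existsNP[t /contrapT tM].
have [|M' MM' dM'] := IH (fire N t M); first by have := mwt_fire rN tM; lia.
by exists M' => //; apply: star_step MM'; exists t.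
Qed.

(** * Paths of places and the tokens on them *)

Lemma pstep_rk N p q : ranked N -> star (pstep N) p q -> rk q <= rk p.
Proof.
move=> rN; elim=> // a b c [t [tN at_ bt]] _ IH.
by have := rk_lt rN tN at_ bt; lia.
Qed.

Lemma pstep_po N p : ranked N -> p \in pl N -> star (pstep N) p (po N).
Proof.
move=> rN; have [n] := ubnP (rk p); elim: n p => // n IH p ltn pN.
have [->|ppo] := eqVneq p (po N); first exact: star_refl.
have [t tN pt] := out_ex rN pN ppo; have [q qt] := post_ex rN tN.
apply: (star_step (y := q)); first by exists t.
by apply: IH (post_sub rN tN qt); have := rk_lt rN tN pt qt; lia.
Qed.

Lemma reachable_pl N M p : ranked N -> reachable N M -> 0 < M p -> p \in pl N.
Proof.
move=> rN iM; move: p.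
apply: (star_invariant (P := fun M => forall p, 0 < M p -> p \in pl N)) iM.
  move=> M1 _ IH [t [tN _] ->] p; rewrite /fire.
  by case: (boolP (p \in post N t)) => [/(post_sub rN tN)//|_ ?]; apply: IH; lia.
by move=> p; rewrite /init_marking; case: eqP => // ->; rewrite pi_pl.
Qed.

(* By free choice the two tokens can be pushed towards [po] along the path
   joining them, until both lie on [po] in a dead marking. *)
Lemma path_unmarked N M p q : good N -> reachable N M ->
  star (pstep N) p q -> 0 < M p -> 0 < M q -> (p = q -> 1 < M p) -> False.
Proof.
move=> gN; have [n] := ubnP (mwt M); elim: n M p q => // n IH M p q ltn iM.
move=> pq Mp Mq Mpq.
have pN := reachable_pl gN iM Mp; have qN := reachable_pl gN iM Mq.
case: (EM (dead N M)) => [dM|].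
  have := dead_final gN iM dM; rewrite /final_marking => fM.
  move: Mp Mq Mpq; rewrite !fM //.
  by case: eqP => // ->; case: eqP => // -> _ _ /(_ erefl).
move=> /existsNP[u /contrapT uM]; have [uN _] := uM.
have step v p' q' : enabled N v M -> star (pstep N) p' q' ->
    0 < fire N v M p' -> 0 < fire N v M q' -> (p' = q' -> 1 < fire N v M p') ->
    False.
  move=> vM; apply: IH; first by have := mwt_fire gN vM; lia.
  by apply: star_rcons iM _; exists v.
have [pu|pu] := boolP (p \in pre N u).
- have [epq|/eqP npq] := eqVneq p q.
  + have [p' p'u] := post_ex gN uN; have lt := rk_lt gN uN pu p'u.
    apply: (step u p p') => //.
    * by apply: star_step (star_refl _ _); exists u.
    * by rewrite /fire pu; have := Mpq epq; lia.
    * exact: fire_post.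
    * by move=> epp; move: lt; rewrite epp ltnn.
  + case: pq npq Mpq Mp Mq pu {pN qN} => // a b c [v [vN av bv]] bc nac _ Ma Mc au.
    (* The first transition [v] of the path is fired instead of [u]: free choice enables it, and it
       moves a token from [a] to [b]. Ranks keep [c] out of its inputs, so the token on [c]
       stays. *)
    have vM := enabled_same_pre gN uM vN au av.
    have cv : c \notin pre N v.
      apply/negP => cv; have := rk_lt gN vN cv bv; have := pstep_rk gN bc; lia.
    apply: (step v b c) => //; first exact: fire_post.
      by apply: leq_trans (fire_keep M cv).
    by move=> ebc; rewrite /fire bv ebc (negbTE cv); lia.
- have Mp' := fire_keep M pu.
  have [qu|qu] := boolP (q \in pre N u).
  + have [q' q'u] := post_ex gN uN; have lt := rk_lt gN uN qu q'u.
    apply: (step u p q') => //; [|lia|exact: fire_post|].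
      by apply: star_rcons pq _; exists u.
    by move=> epq; have := pstep_rk gN pq; rewrite epq; lia.
  + have Mq' := fire_keep M qu.
    by apply: (step u p q) => //; [lia|lia|move=> /Mpq; lia].
Qed.

Lemma safe N M p : good N -> reachable N M -> M p <= 1.
Proof.
move=> gN iM; rewrite leqNgt; apply/negP => Mp.
by apply: (path_unmarked gN iM (star_refl _ p)) => //; lia.
Qed.

Lemma token_consumed N M M' p : star (mstep N) M M' -> 0 < M p -> M' p = 0 ->
  exists M'' t, [/\ star (mstep N) M M'', enabled N t M'' & p \in pre N t].
Proof.
elim=> [a|a _ c [t ta ->] bc IH ap cp]; first by lia.
have [pt|pt] := boolP (p \in pre N t); first by exists a, t; split=> //; apply: star_refl.
have [|M'' [u [bM uM pu]]] := IH _ cp; first by have := fire_keep a pt; lia.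
by exists M'', u; split=> //; apply: star_step bM; exists t.
Qed.

(* Soundness forces some transition to consume the token on [p]; by free choice
   it can be replaced by [t]. *)
Lemma marked_enables N M p t : good N -> reachable N M -> 0 < M p ->
  t \in tr N -> p \in pre N t ->
  exists2 M', star (mstep N) M M' & enabled N t M'.
Proof.
move=> gN iM Mp tN pt; have [M1 MM1 dM1] := reach_dead M gN.
have fM1 := dead_final gN (star_trans iM MM1) dM1.
have ppo : p != po N by apply: contraNneq (po_pre gN tN) => <-.
have [|M2 [u [MM2 uM2 pu]]] := token_consumed MM1 Mp.
  by rewrite fM1 ?(pre_sub gN tN) // /final_marking (negbTE ppo).
by exists M2 => //; apply: (enabled_same_pre gN uM2 tN pu pt).
Qed.

(** Iterating [marked_enables] steers the token along the path: each transition of the path can be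
    enabled and fired in turn. *)
Lemma path_enables N M p q t : good N -> reachable N M -> 0 < M p ->
  star (pstep N) p q -> t \in tr N -> q \in pre N t ->
  exists2 M', star (mstep N) M M' & enabled N t M'.
Proof.
move=> gN iM Mp pq; elim: pq M iM Mp => [a|a b c [u [uN au bu]] _ IH] M iM Mp tN qt.
  exact: marked_enables gN iM Mp tN qt.
have [M1 MM1 uM1] := marked_enables gN iM Mp uN au.
have M12 : star (mstep N) M (fire N u M1) by apply: star_rcons MM1 _; exists u.
have [|M3 M23 tM3] := IH _ (star_trans iM M12) _ tN qt; first exact: fire_post.
by exists M3 => //; apply: star_trans M12 M23.
Qed.

(** * Irreducible nets *)

Definition mergeable N t u : Prop :=
  [/\ t \in tr N, u \in tr N & t != u] /\
  (pre N t =i pre N u /\ post N t =i post N u).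

(** The guard of the d-shortcut rule for the cluster of [u]: if no other transition shares an input
    with [u], this cluster is just [u] with its input places, and it is free choice. *)
Definition shortcutable N t u : Prop :=
  [/\ t \in tr N, u \in tr N, {subset pre N u <= post N t} &
      forall v p, v \in tr N -> p \in pre N u -> p \in pre N v -> v = u].

Definition trivial N : Prop :=
  exists t, [/\ forall u, u \in tr N <-> u = t,
                forall p, p \in pre N t <-> p = pi N,
                forall p, p \in post N t <-> p = po N &
                forall p, p \in pl N <-> p = pi N \/ p = po N].

Definition conflict N M : Prop := exists t u p,
  [/\ t != u, enabled N t M, enabled N u M, p \in pre N t & p \in pre N u].

(** The subtraction yields the tokens left over once [t] has consumed its inputs. It depends on [t]
    only through [pre N t], so conflicting transitions of a free choice net have the same downstream
    places. *)
Definition downstream N t M q : Prop :=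
  exists2 p, 0 < M p - (p \in pre N t) & star (pstep N) p q.

Lemma downstream_step N t M p q u : u \in tr N -> p \in pre N u ->
  q \in post N u -> downstream N t M p -> downstream N t M q.
Proof. by move=> uN pu qu [p0 Mp0 p0p]; exists p0 => //; apply: star_rcons p0p _; exists u. Qed.

Section Irreducible.

Variables (N : net col) (t : nat) (M : marking).
Hypotheses (gN : good N) (iM : reachable N M) (tM : enabled N t M).
Hypothesis no_shortcut : forall u, ~ shortcutable N t u.
Hypothesis no_conflict :
  forall M', star (mstep N) (fire N t M) M' -> ~ conflict N M'.

Lemma fire_reachable M' : star (mstep N) (fire N t M) M' -> reachable N M'.
Proof. by apply: star_trans; apply: star_rcons iM _; exists t. Qed.

(** Otherwise all inputs of [u] are outputs of [t]. Another transition sharing an input with [u]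
    would be enabled too, which is a conflict; so [t] would admit a d-shortcut through [u]. *)
Lemma enabled_downstream M' u : star (mstep N) (fire N t M) M' ->
  (forall p, 0 < M' p -> downstream N t M p \/ p \in post N t) ->
  enabled N u M' -> exists2 p, p \in pre N u & downstream N t M p.
Proof.
move=> MM' mM' uM'; have [uN pM'] := uM'; apply: contrapT => nD.
apply: (no_shortcut (u := u)); split=> //; first by case: tM.
  by move=> p pu; case: (mM' p (pM' p pu)) => // Dp; case: nD; exists p.
move=> v p vN pu pv; apply: contrapT => /eqP nvu; apply: (no_conflict MM').
by exists v, u, p; split=> //; apply: (enabled_same_pre gN uM' vN pu pv).
Qed.

(** An invariant of the runs after [t]: by [enabled_downstream] each firing consumes a downstream
    token, so all its outputs are downstream. *)
Lemma marked_downstream M' p : star (mstep N) (fire N t M) M' -> 0 < M' p ->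
  downstream N t M p \/ p \in post N t.
Proof.
move=> MM'; pose P M1 := star (mstep N) (fire N t M) M1 /\
  forall p, 0 < M1 p -> downstream N t M p \/ p \in post N t.
suff [_ PM'] : P M' by apply: PM'.
apply: star_invariant MM' => [M1 _ [MM1 mM1] [u uM1 ->]|].
  split; first by apply: star_rcons MM1 _; exists u.
  move=> q; have [r ru Dr] := enabled_downstream MM1 mM1 uM1.
  have [uN _] := uM1; rewrite /fire; case: (boolP (q \in post N u)) => [qu _|_ ?].
    by left; apply: (downstream_step uN ru).
  by apply: mM1; lia.
split=> [|q]; first exact: star_refl.
rewrite {1}/fire; case: (boolP (q \in post N t)); first by right.
by rewrite addn0 => _ Mq; left; exists q => //; apply: star_refl.
Qed.

Lemma step_downstream M' u : star (mstep N) (fire N t M) M' ->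
  enabled N u M' -> exists2 p, p \in pre N u & downstream N t M p.
Proof.
by move=> MM'; apply: (enabled_downstream MM') => p; apply: marked_downstream.
Qed.

(** Right after [t], the left-over token and the token on [q] would lie on a common path, or both on
    [q], against [path_unmarked]. *)
Lemma post_not_downstream q : q \in post N t -> ~ downstream N t M q.
Proof.
move=> qt [p Mp pq].
apply: (path_unmarked gN (fire_reachable (star_refl _ _)) pq).
- by rewrite /fire; lia.
- exact: fire_post.
- by move=> epq; rewrite /fire epq qt -epq; lia.
Qed.

End Irreducible.

(* If [q] is an output of [t] only, then [q] is not downstream of the tokens
   left over by [t] (path_unmarked), while any transition consuming [q] after
   [t] is.  By path_enables that transition can also be enabled after [u], where
   [q] can only have been marked from the left-over tokens: a contradiction. *)
Lemma conflict_post N t u M : good N -> reachable N M ->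
  enabled N t M -> enabled N u M -> pre N t =i pre N u ->
  (forall v, ~ shortcutable N t v) -> (forall v, ~ shortcutable N u v) ->
  (forall M', star (mstep N) (fire N t M) M' -> ~ conflict N M') ->
  (forall M', star (mstep N) (fire N u M) M' -> ~ conflict N M') ->
  {subset post N t <= post N u}.
Proof.
move=> gN iM tM uM etu nst nsu nct ncu q qt; apply: contrapT => /negP qu.
have Dtu p : downstream N t M p <-> downstream N u M p.
  by split=> -[p0]; [rewrite etu|rewrite -etu]; exists p0.
have nDq := post_not_downstream gN iM tM qt.
have [tN _] := tM; have qN := post_sub gN tN qt.
have it := fire_reachable iM tM; have iu := fire_reachable iM uM.
have Mu : 0 < fire N u M q -> False.
  by move/(marked_downstream gN uM nsu ncu (star_refl _ _)) => -[/Dtu|]//; apply/negP.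
(* If [q] is [po N], every left-over token would have a path to it, so none is left. Hence the
   marking after [u] is dead, therefore final, and it marks [q]. *)
have [eq|nq] := eqVneq q (po N).
  have noD p : ~ downstream N t M p.
    move=> [p0 Mp0 _]; apply: nDq; exists p0 => //; rewrite eq.
    by apply: (pstep_po gN); apply: (reachable_pl gN iM); lia.
  have du : dead N (fire N u M).
    move=> v /(step_downstream gN uM nsu ncu (star_refl _ _)) [p _ /Dtu].
    exact: noD.
  apply: Mu; rewrite (dead_final gN (iu _ (star_refl _ _)) du qN).
  by rewrite eq /final_marking eqxx.
have [v vN qv] := out_ex gN qN nq.
have [M' tM' vM'] := marked_enables gN (it _ (star_refl _ _)) (fire_post M qt) vN qv.
have [p pv [p0 Mp0 p0p]] := step_downstream gN tM nst nct tM' vM'.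
have Mup0 : 0 < fire N u M p0 by rewrite /fire -etu addn_gt0 Mp0.
have [M2 uM2 [_ vM2]] := path_enables gN (iu _ (star_refl _ _)) Mup0 p0p vN pv.
case: (marked_downstream gN uM nsu ncu uM2 (vM2 _ qv)) => [/Dtu//|].
exact/negP.
Qed.

(* Runs terminate, so some reachable conflict is followed by no other one. *)
Lemma minimal_conflict N M : ranked N -> reachable N M -> conflict N M ->
  exists2 M', reachable N M' & conflict N M' /\
    forall t, enabled N t M' ->
      forall M1, star (mstep N) (fire N t M') M1 -> ~ conflict N M1.
Proof.
move=> rN; have [n] := ubnP (mwt M); elim: n M => // n IH M ltn iM cM.
case: (EM (exists t M1, [/\ enabled N t M, star (mstep N) (fire N t M) M1 & conflict N M1])).
  move=> [t [M1 [tM tM1 cM1]]]; apply: (IH M1) => //; last first.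
    by apply: star_trans iM _; apply: star_step tM1; exists t.
  suff : mwt M1 <= mwt (fire N t M) by have := mwt_fire rN tM; lia.
  elim: tM1 {IH ltn iM cM cM1 tM} => // a _ c [u ua ->] _.
  by have := mwt_fire rN ua; lia.
move=> nM; exists M => //; split=> // t tM M1 tM1 cM1.
by apply: nM; exists t, M1.
Qed.

Lemma irreducible_trivial N : good N ->
  (forall t u, ~ mergeable N t u) -> (forall t u, ~ shortcutable N t u) ->
  trivial N.
Proof.
move=> gN nm ns.
have nc M : reachable N M -> ~ conflict N M.
  move=> iM cM; have [M1 iM1 [[t [u [p [ntu tM uM pt pu]]]] nc]] := minimal_conflict gN iM cM.
  have [[tN _] [uN _]] := (tM, uM).
  have etu := same_pre gN tN uN pt pu.
  have nct := nc t tM; have ncu := nc u uM.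
  apply: (nm t u); split=> //; split=> // q; apply/idP/idP.
    exact: (conflict_post gN iM1 tM uM etu (ns t) (ns u) nct ncu).
  exact: (conflict_post gN iM1 uM tM (fsym etu) (ns u) (ns t) ncu nct).
have i0 : reachable N (init_marking N) := star_refl _ _.
have [t tM] : exists t, enabled N t (init_marking N).
  apply: contrapT => nt.
  have d : dead N (init_marking N) by move=> t tM; apply: nt; exists t.
  have := dead_final gN i0 d (pi_pl gN).
  by rewrite /init_marking /final_marking eqxx (negbTE (pi_neq_po gN)).
have preE u p : enabled N u (init_marking N) -> p \in pre N u <-> p = pi N.
  move=> [uN pM].
  have H q : q \in pre N u -> q = pi N by move/pM; rewrite /init_marking; case: eqP.
  by split=> [/H//|->]; have [q qu] := pre_ex gN uN; rewrite -(H q qu).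
have [tN _] := tM.
have nc1 M' : star (mstep N) (fire N t (init_marking N)) M' -> ~ conflict N M'.
  by move=> /(fire_reachable i0 tM); apply: nc.
(* The only initial token lies on [pi N] and [t] consumes it. Nothing is left over, so the marking
   after [t] is dead. *)
have noD p : ~ downstream N t (init_marking N) p.
  move=> [q + _]; rewrite /init_marking; case: eqP => [->|]; last by lia.
  by have -> : pi N \in pre N t by apply/(preE t).
have d1 : dead N (fire N t (init_marking N)).
  by move=> u /(step_downstream gN tM (ns t) nc1 (star_refl _ _)) [p _ /noD].
have uniq_init u : enabled N u (init_marking N) -> u = t.
  move=> uM; apply: contrapT => /eqP nut; apply: (nc _ i0).
  by exists u, t, (pi N); split=> //; [apply/(preE u)|apply/(preE t)].
(* Only two markings are reachable and the second is dead, so liveness makes every transition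
   initially enabled. *)
have trE u : u \in tr N -> u = t.
  move=> uN; have [M iM uM] := live gN uN.
  have [eM|[M1 [v vM ->] vM1]] := star_first iM; first by apply: uniq_init; rewrite eM.
  rewrite (uniq_init v vM) in vM1.
  have [eM|[M2 [w wM _] _]] := star_first vM1; last by case: (d1 w).
  by case: (d1 u); rewrite eM.
have M1E p : fire N t (init_marking N) p = (p \in post N t).
  by case: (posnP (init_marking N p - (p \in pre N t))) => [|Mp];
    [rewrite /fire => ->|case: (noD p); exists p => //; apply: star_refl].
have postE p : p \in post N t <-> p = po N.
  have pF q : q \in pl N -> (q \in post N t) = (q == po N).
    move=> qN; have := dead_final gN (fire_reachable i0 tM (star_refl _ _)) d1 qN.
    by rewrite M1E /final_marking; case: (_ \in _); case: (_ == _).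
  split=> [pt|->]; first by apply/eqP; rewrite -pF // (post_sub gN tN).
  by rewrite pF ?eqxx ?(po_pl gN).
exists t; split=> //.
- by move=> u; split=> [/trE//|->].
- by move=> p; apply: preE.
- move=> p; split=> [pN|[->|->]]; [|exact: (pi_pl gN)|exact: (po_pl gN)].
  have [->|np] := eqVneq p (pi N); [by left|right].
  by have [u /trE-> pu] := in_ex gN pN np; apply/postE.
Qed.

(** * Marked places, fresh names and the termination measure *)

Lemma reachable_marked N M p : reachable N M -> 0 < M p ->
  p = pi N \/ exists2 t, t \in tr N & p \in post N t.
Proof.
move=> iM; move: p; apply: (star_invariant (P := fun M => forall p, 0 < M p ->
  p = pi N \/ exists2 t, t \in tr N & p \in post N t)) iM.
  move=> M1 _ IH [t [tN _] ->] p; rewrite /fire.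
  by case: (boolP (p \in post N t)) => [pt _|_ ?]; [right; exists t|apply: IH; lia].
by move=> p; rewrite /init_marking; case: eqP => // -> _; left.
Qed.

Definition fresh N := (\max_(u <- tr N) u).+1.

Lemma fresh_notin N : fresh N \notin tr N.
Proof.
apply/negP => fN.
by have := leq_bigmax_seq (P := xpredT) (F := id) _ fN isT; rewrite /= ltnn.
Qed.

(** Duplicates are removed because [tr N] is only read as a set. The successor gives every
    transition a positive cost, so that merging two into one lowers the sum. *)
Definition nwt N := \sum_(u <- undup (tr N)) (wt (post N u)).+1.

Lemma sum_undupD1 s (P : pred nat) (F : nat -> nat) x : x \in s -> P x ->
  \sum_(u <- undup s | P u) F u = F x + \sum_(u <- undup s | P u && (u != x)) F u.
Proof.
move=> xs Px; rewrite (bigID (pred1 x)) /=; congr (_ + _).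
rewrite -big_filter (eq_filter (a2 := pred1 x)); last first.
  by move=> u /=; case: eqP => [->|]; rewrite ?Px ?andbF.
by rewrite filter_pred1_uniq ?undup_uniq ?mem_undup // big_seq1.
Qed.

(** * The merge rule *)

Section Merge.

Variables (N : net col) (t1 t2 : nat).
Hypotheses (gN : good N) (mg : mergeable N t1 t2).

Definition merge_net : net col :=
  @Net col (pl N) (fresh N :: [seq u <- tr N | (u != t1) && (u != t2)])
    (fun u => if u == fresh N then merge_trans (td N t1) (td N t2) else td N u)
    (pi N) (po N).

(** On markings the merged transition is a copy of [t1]. This map and its converse [image] show that
    both nets have the same steps. *)
Let orig u := if u == fresh N then t1 else u.

Let pre_orig u : pre merge_net u = pre N (orig u).
Proof. by rewrite /pre /orig /=; case: (u == _). Qed.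

Let post_orig u : post merge_net u = post N (orig u).
Proof. by rewrite /post /orig /=; case: (u == _). Qed.

Let orig_tr u : u \in tr merge_net -> orig u \in tr N.
Proof.
have [[t1N _ _] _] := mg; rewrite in_cons mem_filter /orig.
by case: eqP => //= _ /andP[].
Qed.

Let image u : u \in tr N -> exists2 v, v \in tr merge_net &
  pre merge_net v =i pre N u /\ post merge_net v =i post N u.
Proof.
move=> uN; have [[t1N t2N n12] [epre epost]] := mg.
have [e12|] := boolP ((u == t1) || (u == t2)).
  exists (fresh N); first exact: mem_head.
  rewrite pre_orig post_orig /orig eqxx.
  by case/orP: e12 => /eqP->.
rewrite negb_or => u12; exists u; first by rewrite in_cons mem_filter u12 uN orbT.
have nf : u != fresh N by apply: contraTneq uN => ->; exact: fresh_notin.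
by rewrite pre_orig post_orig /orig (negbTE nf).
Qed.

Lemma merge_net_step : merge_step N merge_net.
Proof.
have [[t1N t2N n12] [epre epost]] := mg.
exists t1, t2, (fresh N); split=> //; first exact: fresh_notin.
split=> //=; first by rewrite eqxx.
by move=> u _ /negbTE->.
Qed.

Lemma merge_net_ranked : ranked merge_net.
Proof.
split=> //=; try by case: gN => -[].
- by move=> t /orig_tr tN; rewrite pre_orig; exact: (pre_sub gN tN).
- by move=> t /orig_tr tN; rewrite post_orig; exact: (post_sub gN tN).
- by move=> t /orig_tr tN; rewrite post_orig; exact: (pi_post gN tN).
- by move=> t /orig_tr tN; rewrite pre_orig; exact: (po_pre gN tN).
- by move=> t /orig_tr tN; rewrite pre_orig; exact: (pre_ex gN tN).
- by move=> t /orig_tr tN; rewrite post_orig; exact: (post_ex gN tN).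
- move=> p pN np; have [t /image[u uN' [epre _]] pt] := out_ex gN pN np.
  by exists u; rewrite ?epre.
- by move=> t p q /orig_tr tN; rewrite pre_orig post_orig; exact: (rk_lt gN tN).
- by move=> t u p /orig_tr tN /orig_tr uN; rewrite !pre_orig; exact: (same_pre gN tN uN).
- move=> t; rewrite in_cons mem_filter /pre /post /=; case: eqP => [_ _ a|_ /= /andP[_ tN]].
    have [[t1N _ _] _] := mg; have [b ab] := total gN t1N a.
    by exists b; left.
  exact: (total gN tN).
Qed.

Let enabled_orig u M : enabled merge_net u M -> enabled N (orig u) M.
Proof. by move=> [/orig_tr uN pM]; split=> // p; rewrite -pre_orig; apply: pM. Qed.

Let enabled_image u M : enabled N u M -> exists2 v, enabled merge_net v M &
  fire merge_net v M = fire N u M.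
Proof.
move=> [/image[v vN' [epre epost]] pM]; exists v.
  by split=> // p; rewrite epre; apply: pM.
by apply: funext => p; rewrite /fire epre epost.
Qed.

Lemma merge_net_reachable M : reachable merge_net M <-> reachable N M.
Proof.
split; (apply: star_invariant; last exact: star_refl) => M1 _ iM [u uM ->].
  apply: star_rcons iM _; exists (orig u); first exact: enabled_orig.
  by rewrite /fire pre_orig post_orig.
have [v vM <-] := enabled_image uM.
by apply: star_rcons iM _; exists v.
Qed.

Lemma merge_net_good : good merge_net.
Proof.
split; first exact: merge_net_ranked.
- move=> p pN np; have [t /image[u uN' [_ epost]] pt] := in_ex gN pN np.
  by exists u; rewrite ?epost.
- move=> M /merge_net_reachable iM dM; apply: (dead_final gN iM).
  by move=> u /enabled_image[v /dM].
- move=> t tN'; have [M iM [_ tM]] := live gN (orig_tr tN').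
  by exists M; [apply/merge_net_reachable|split=> // p; rewrite pre_orig; apply: tM].
Qed.

Lemma merge_net_nwt : nwt merge_net < nwt N.
Proof.
have [[t1N t2N n12] [epre epost]] := mg.
have nf : fresh N \notin [seq u <- tr N | (u != t1) && (u != t2)].
  by rewrite mem_filter (negbTE (fresh_notin N)) andbF.
rewrite /nwt /= (negbTE nf) big_cons -filter_undup big_filter.
rewrite (sum_undupD1 (P := xpredT) _ t1N) // (@sum_undupD1 _ _ _ t2) //= 1?eq_sym //.
(* The term of the fresh transition cancels that of [t1]; the successor in the term of [t2] gives
   strictness. *)
rewrite {1}/post /= eqxx ltn_add2l addSn ltnS; apply: leq_trans (leq_addl _ _).
apply: eq_leq; rewrite big_seq_cond [RHS]big_seq_cond; apply: eq_bigr => u.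
rewrite mem_undup => /andP[uN _]; rewrite /post /=.
by case: eqP uN (fresh_notin N) => // -> ->.
Qed.

End Merge.

(** * The d-shortcut rule *)

Section Shortcut.

Variables (N : net col) (t t' : nat).
Hypotheses (gN : good N) (sc : shortcutable N t t').

Let tN : t \in tr N. Proof. by case: sc. Qed.
Let t'N : t' \in tr N. Proof. by case: sc. Qed.
Let pre_post p : p \in pre N t' -> p \in post N t.
Proof. by case: sc => _ _ + _; apply. Qed.
Let single u p : u \in tr N -> p \in pre N t' -> p \in pre N u -> u = t'.
Proof. by case: sc => _ _ _; apply. Qed.

Let pre_post' p : p \in pre N t' -> p \notin post N t'.
Proof. by move=> pt; apply/negP => /(rk_lt gN t'N pt); rewrite ltnn. Qed.

Let neq_tt' : t != t'.
Proof.
apply/eqP => e; have [p pt] := pre_ex gN t'N.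
by have := pre_post pt; rewrite e (negbTE (pre_post' pt)).
Qed.

Let enabled_t' M : enabled N t M -> enabled N t' (fire N t M).
Proof. by move=> _; split=> // p /pre_post; apply: fire_post. Qed.

Let fire_t_reachable M : reachable N M -> enabled N t M -> reachable N (fire N t M).
Proof. by move=> iM tM; apply: star_rcons iM _; exists t. Qed.

(** By liveness [t] can fire, and [t'] right after it; a common output would then carry two tokens,
    against [safe]. *)
Let post_post' p : p \in post N t -> p \notin post N t'.
Proof.
move=> pt; apply/negP => pt'; have [M iM tM] := live gN tN.
have iM' : reachable N (fire N t' (fire N t M)).
  apply: star_rcons (fire_t_reachable iM tM) _; exists t' => //.
  exact: enabled_t'.
have := safe p gN iM'; rewrite /fire pt pt'.
have -> : (p \in pre N t') = false by apply/negP => /pre_post'; rewrite pt'.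
by lia.
Qed.

(* Since [N] is sound, the cluster of [t'] survives as soon as some place of it
   keeps an input transition. *)
Definition kept : bool :=
  has (fun u => (u != t) && has (fun p => p \in post N u) (pre N t')) (tr N).

Definition shortcut_net : net col :=
  @Net col [seq p <- pl N | kept || (p \notin pre N t')]
    (fresh N :: [seq u <- tr N | (u != t) && (kept || (u != t'))])
    (fun u => if u == fresh N then shortcut_trans (td N t) (td N t') else td N u)
    (pi N) (po N).

Local Notation N' := shortcut_net.
Local Notation ts := (fresh N).

Let neq_ts u : u \in tr N -> u != ts.
Proof. by apply: contraTneq => ->; exact: fresh_notin. Qed.

Let orig u := if u == ts then t else u.

Let pre_orig u : pre N' u = pre N (orig u).
Proof. by rewrite /pre /orig /=; case: (u == _). Qed.

Let post_ts : post N' ts = [seq p <- post N t | p \notin pre N t'] ++ post N t'.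
Proof. by rewrite /post /= eqxx. Qed.

Let mem_post_ts p : p \in post N' ts =
  (p \notin pre N t') && (p \in post N t) || (p \in post N t').
Proof. by rewrite post_ts mem_cat mem_filter. Qed.

Let post_old u : u != ts -> post N' u = post N u.
Proof. by rewrite /post /= => /negbTE->. Qed.

Let in_trN' u : u \in tr N' = (u == ts) || [&& u != t, kept || (u != t') & u \in tr N].
Proof. by rewrite in_cons mem_filter andbA. Qed.

Let in_plN' p : p \in pl N' = (kept || (p \notin pre N t')) && (p \in pl N).
Proof. by rewrite mem_filter. Qed.

Let ts_tr : ts \in tr N'. Proof. exact: mem_head. Qed.

Let orig_tr u : u \in tr N' -> orig u \in tr N.
Proof. by rewrite in_trN' /orig; case: eqP => //= _ /and3P[]. Qed.

Let trN'P u : u \in tr N' -> u = ts \/ [/\ u \in tr N, u != ts, u != t & kept || (u != t')].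
Proof.
rewrite in_trN' => /orP[/eqP->|/and3P[ut k uN]]; first by left.
by right; split=> //; apply: neq_ts.
Qed.

Let keptP : reflect (exists u p, [/\ u \in tr N, u != t, p \in pre N t' & p \in post N u]) kept.
Proof.
apply: (iffP hasP) => [[u uN /andP[ut /hasP[p pt pu]]]|[u [p [uN ut pt pu]]]].
  by exists u, p.
by exists u => //; rewrite ut; apply/hasP; exists p.
Qed.

Let clus_t' z : clus N (inr t') z <->
  match z with inl p => p \in pl N /\ p \in pre N t' | inr u => u = t' end.
Proof.
split=> [|].
  elim=> // [p u _ [_ pt] pN uN pu|u p _ -> _ pN pt //].
  exact: single uN pt pu.
case: z => [p [pN pt]|u ->]; last exact: clus_self.
by apply: (clus_tp (t := t')) => //; apply: clus_self.
Qed.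

Lemma shortcut_net_step : dshortcut_step N N'.
Proof.
exists t, (inr t'), t', ts; split=> //.
- split=> //.
    by move=> p u /clus_t'[pN pt] /clus_t'->.
  by move=> p /clus_t'[_ /pre_post].
- split=> [e|e].
    have /e : clus N (inl (po N)) (inl (po N)) by apply: clus_self.
    by move=> /clus_t'[_]; apply/negP; exact: (po_pre gN t'N).
  have /e : clus N (inr t) (inr t) by apply: clus_self.
  by move=> /clus_t' e'; move: neq_tt'; rewrite e' eqxx.
- by split=> //; [apply: clus_self|move=> u _ /clus_t'].
- exact: fresh_notin.
move=> tr1 post1 removed.
(* The new transition puts no token on the cluster, so only an old transition other than [t] can
   preserve it. *)
have remP : removed <-> ~~ kept.
  split=> [rem|nk p /clus_t'[pN pt] u].
    apply/keptP => -[u [p [uN ut pt pu]]].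
    have := rem p _ u; rewrite /tr1 /post1 (negbTE (neq_ts uN)) uN ut pu.
    by move=> H; apply: notF; apply: H => //; apply/clus_t'; rewrite (pre_sub gN t'N).
  rewrite /tr1 /post1; case: eqP => [_ _|_ /= /andP[uN ut]].
    by rewrite mem_cat mem_filter pt /= pre_post'.
  by apply: contra nk => pu; apply/keptP; exists u, p.
split=> //=.
- move=> p; rewrite -[X in X <-> _]/(is_true (p \in pl N')) in_plN'; split.
    case/andP=> k pN; split=> // -[/remP nk /clus_t'[_ pt]].
    by move: k; rewrite (negbTE nk) pt.
  move=> [pN nr]; rewrite pN andbT; apply: contrapT => /negP.
  rewrite negb_or negbK => /andP[nk pt]; apply: nr; split; first exact/remP.
  exact/clus_t'.
- move=> u; rewrite -[X in X <-> _]/(is_true (u \in tr N')) in_trN' /tr1; split.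
    case/orP=> [/eqP->|/and3P[ut k uN]].
      rewrite eqxx; split=> // -[_ /clus_t' e].
      by have := neq_ts t'N; rewrite e eqxx.
    rewrite uN ut orbT; split=> // -[/remP nk /clus_t' e].
    by move: k; rewrite (negbTE nk) e eqxx.
  move=> [/orP[->//|/andP[uN ut]] nr]; rewrite uN ut andbT.
  apply/orP; right; apply: contrapT => /negP; rewrite negb_or negbK => /andP[nk /eqP e].
  by apply: nr; split; [apply/remP|apply/clus_t'].
- by rewrite eqxx.
- by move=> u _ /negbTE->.
Qed.

Lemma shortcut_net_ranked : ranked N'.
Proof.
split=> //.
- rewrite in_plN' (pi_pl gN) andbT; apply/orP; right.
  by apply: contra (pi_post gN tN) => /pre_post.
- by rewrite in_plN' (po_pl gN) andbT (po_pre gN t'N) orbT.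
- exact: (pi_neq_po gN).
- by move=> p; rewrite in_plN' => /andP[_]; apply: (pl_sub gN).
- move=> u uN' p; have oN := orig_tr uN'.
  rewrite pre_orig in_plN' => pu; rewrite (pre_sub gN oN) // andbT.
  have [pt|//] := boolP (p \in pre N t'); last by rewrite orbT.
  (* A place of the cluster feeds only [t'], which survives only if the cluster is kept. *)
  have := single oN pt pu; rewrite /orig.
  case: (trN'P uN') => [-> |[_ /negbTE-> _ k] e]; last by move: k; rewrite e eqxx => ->.
  by rewrite eqxx => e; move: neq_tt'; rewrite e eqxx.
- move=> u /trN'P[->|[uN us ut k]] p; rewrite in_plN'.
    rewrite mem_post_ts => /orP[/andP[npt /(post_sub gN tN) ->]|pt'].
      by rewrite npt orbT.
    rewrite (post_sub gN t'N) // andbT; apply/orP; right.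
    by apply/negP => /pre_post'; rewrite pt'.
  rewrite post_old // => pu; rewrite (post_sub gN uN) // andbT.
  have [pt|//] := boolP (p \in pre N t'); last by rewrite orbT.
  by apply/orP; left; apply/keptP; exists u, p.
- move=> u /trN'P[->|[uN us ut k]].
    by rewrite mem_post_ts !negb_or negb_and (pi_post gN tN) orbT (pi_post gN t'N).
  by rewrite post_old // (pi_post gN uN).
- by move=> u /orig_tr uN; rewrite pre_orig; exact: (po_pre gN uN).
- by move=> u /orig_tr uN; rewrite pre_orig; exact: (pre_ex gN uN).
- move=> u /trN'P[->|[uN us ut k]].
    have [p pt'] := post_ex gN t'N.
    by exists p; rewrite mem_post_ts pt' orbT.
  by rewrite post_old //; exact: (post_ex gN uN).
- move=> p; rewrite in_plN' => /andP[k pN] np.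
  have [w wN pw] := out_ex gN pN np.
  have [e|nwt] := eqVneq w t.
    by exists ts => //; rewrite pre_orig /orig eqxx -e.
  exists w; last by rewrite pre_orig /orig (negbTE (neq_ts wN)).
  rewrite in_trN' nwt wN andbT; apply/orP; right.
  by case/orP: k => [->//|npt]; apply/orP; right; apply: contraNneq npt => <-.
- move=> u p q uN'; have oN := orig_tr uN'; rewrite pre_orig => pu.
  case: (trN'P uN') pu => [->|[uN us ut k]]; last first.
    by rewrite post_old // /orig (negbTE us); exact: (rk_lt gN uN).
  rewrite /orig eqxx mem_post_ts => pt /orP[/andP[_]|qt']; first exact: (rk_lt gN tN pt).
  (* The rank drops twice, through an input [r] of [t'], which is an output of [t]. *)
  have [r rt'] := pre_ex gN t'N.
  by have := rk_lt gN t'N rt' qt'; have := rk_lt gN tN pt (pre_post rt'); lia.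
- by move=> u v p /orig_tr uN /orig_tr vN; rewrite !pre_orig; exact: (same_pre gN uN vN).
- move=> u; rewrite in_trN' /pre /post /=.
  case: eqP => [_ _ a|_ /= /and3P[_ _ uN]]; last exact: (total gN uN).
  have [m am] := total gN tN a.
  pose a' : asg col (pre N t') := fun p h => m p (pre_post h).
  have [n a'n] := total gN t'N a'.
  (* Colours are chosen as data: from [n] on the outputs of [t'], from [m] elsewhere. Irrelevance of
     membership proofs makes the choice independent of the proof supplied. *)
  have colour p : p \in post N' ts -> {y : col p | (forall h, y = n p h) /\
      (forall h : p \in post N t, p \notin post N t' -> y = m p h)}.
    rewrite mem_post_ts => hp.
    have [h|h] : {p \in post N t'} + {p \notin post N t'}.
      by case: (p \in post N t'); [left|right].
      by exists (n p h); split=> h'; [rewrite (bool_irrelevance h h')|rewrite h].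
    have hm : p \in post N t by move: hp; rewrite (negbTE h) orbF => /andP[].
    exists (m p hm); split=> h'; last by rewrite (bool_irrelevance hm h').
    by move: (h); rewrite h'.
  have tsE p : p \in [seq p <- post N t | p \notin pre N t'] ++ post N t' -> p \in post N' ts.
    by rewrite post_ts.
  exists (fun p h => sval (colour p (tsE p h))), m, a', n; split=> //.
  + by move=> p h1 h2; rewrite /a' (bool_irrelevance (pre_post h1) h2).
  + by move=> p h1 h2; case: (colour _ _) => y [/= ->].
  + by move=> p h1 h2 np; case: (colour _ _) => y [/= _ ->].
Qed.

Let rN' := shortcut_net_ranked.

(** Tokens on the inputs of [t'] are produced and consumed at once, and by [post_post'] the
    remaining outputs form a disjoint union, so taking the union of sets agrees with adding
    tokens. *)
Let fire_ts M : reachable N M -> enabled N t M ->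
  fire N' ts M = fire N t' (fire N t M).
Proof.
move=> iM tM; apply: funext => p; rewrite /fire pre_orig /orig eqxx mem_post_ts.
have := @post_post' p; have := @pre_post p; have := @pre_post' p.
case: (p \in pre N t'); case: (p \in post N t); case: (p \in post N t') => //=; lia.
Qed.

Let fire_old u M : u != ts -> fire N' u M = fire N u M.
Proof.
by move=> us; apply: funext => p; rewrite /fire pre_orig /orig (negbTE us) post_old.
Qed.

Let enabled_orig u M : enabled N' u M -> enabled N (orig u) M.
Proof. by move=> [/orig_tr uN pM]; split=> // p; rewrite -pre_orig; apply: pM. Qed.

Let enabled_ts M : enabled N t M -> enabled N' ts M.
Proof. by move=> [_ pM]; split=> // p; rewrite pre_orig /orig eqxx; apply: pM. Qed.

Let enabled_old u M : u != t -> kept || (u != t') -> enabled N u M -> enabled N' u M.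
Proof.
move=> ut k [uN pM]; split; first by rewrite in_trN' ut k uN orbT.
by move=> p; rewrite pre_orig /orig (negbTE (neq_ts uN)); apply: pM.
Qed.

Lemma shortcut_net_reachable M : reachable N' M -> reachable N M.
Proof.
apply: star_invariant; last exact: star_refl.
move=> M1 _ iM [u uM ->]; have := enabled_orig uM; have [uN' _] := uM.
case: (trN'P uN') => [->|[uN us ut k]]; rewrite /orig.
  rewrite eqxx => tM; rewrite fire_ts //.
  apply: star_rcons (fire_t_reachable iM tM) _; exists t' => //.
  exact: enabled_t'.
by rewrite (negbTE us) fire_old // => uM'; apply: star_rcons iM _; exists u.
Qed.

Let marked_kept M p : reachable N' M -> p \in pre N t' -> 0 < M p -> kept.
Proof.
move=> iM pt /(reachable_pl rN' iM); rewrite in_plN' pt orbF.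
by case/andP.
Qed.

(** If [t] were enabled, so would be [ts]. If [t'] were enabled, its marked inputs would be places
    of the new net, so the cluster would be kept and [t'] with it. *)
Lemma shortcut_net_dead M : reachable N' M -> dead N' M -> dead N M.
Proof.
move=> iM dM u uM; have [ut|ut] := eqVneq u t.
  by apply: (dM ts); apply: enabled_ts; rewrite -ut.
apply: (dM u); apply: enabled_old => //; have [ut'|//] := eqVneq u t'; last by rewrite orbT.
have [p pt] := pre_ex gN t'N.
by rewrite (marked_kept iM pt) //; case: uM => _; apply; rewrite ut'.
Qed.

(* [N'] may be ahead of [N] by one firing of [t']. *)
Lemma shortcut_net_simulates M : reachable N M -> exists2 M', reachable N' M' &
  M' = M \/ enabled N t' M /\ M' = fire N t' M.
Proof.
move=> iM; pose P M := reachable N M /\ exists2 M', reachable N' M' &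
  M' = M \/ enabled N t' M /\ M' = fire N t' M.
suff [] : P M by [].
apply: star_invariant iM; last by split; [|exists (init_marking N); last by left]; apply: star_refl.
move=> {}M _ [iM [M' iM' MM']] [u uM ->].
split; first by apply: star_rcons iM _; exists u.
have [uN pM] := uM.
case: MM' => [e|[t'M e]].
  rewrite {}e in iM'; have [ut|ut] := eqVneq u t.
    (* Firing [ts] in place of [t] puts the new net ahead by [t']. *)
    rewrite {}ut in uM *; exists (fire N t' (fire N t M)).
      rewrite -fire_ts //; apply: (star_rcons iM'); exists ts => //.
      exact: enabled_ts.
    by right; split=> //; apply: enabled_t'.
  exists (fire N u M); last by left.
  rewrite -fire_old ?neq_ts //; apply: (star_rcons iM'); exists u => //.
  apply: enabled_old => //; have [ut'|//] := eqVneq u t'; last by rewrite orbT.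
  have [p pt] := pre_ex gN t'N.
  by rewrite (marked_kept iM' pt) //; apply: pM; rewrite ut'.
have [ut'|ut'] := eqVneq u t'.
  by exists M' => //; left; rewrite e ut'.
(* While [t'] is enabled, firing [t] would put a second token on an input of [t']. *)
have ut : u != t.
  apply/eqP => ut; rewrite {}ut in uM.
  have [p pt] := pre_ex gN t'N; have := safe p gN (fire_t_reachable iM uM).
  have npt : p \notin pre N t.
    by apply/negP => pt2; move: neq_tt'; rewrite (single tN pt pt2) eqxx.
  by rewrite /fire (pre_post pt) (negbTE npt); have := t'M.2 p pt; lia.
(* Any other [u] shares no input with [t'], so the two firings commute and the lead persists. *)
have disj p : p \in pre N u -> p \notin pre N t'.
  by move=> pu; apply/negP => pt; move: ut'; rewrite (single uN pt pu) eqxx.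
have uM' : enabled N u M'.
  by split=> // p pu; rewrite e; apply: leq_trans (pM p pu) (fire_keep M (disj p pu)).
exists (fire N u M').
  rewrite -fire_old ?neq_ts //; apply: (star_rcons iM'); exists u => //.
  by apply: enabled_old => //; rewrite ut' orbT.
right; split.
  split=> // p pt; apply: leq_trans (t'M.2 p pt) (fire_keep M _).
  by apply: contraL pt; apply: disj.
rewrite e; apply: funext => p; rewrite /fire.
have := disj p; have := t'M.2 p; have := pM p.
by case: (p \in pre N u); case: (p \in pre N t') => /=; lia.
Qed.

Let dead_final' M : reachable N' M -> dead N' M ->
  forall p, p \in pl N' -> M p = final_marking N' p.
Proof.
move=> iM dM p; rewrite in_plN' => /andP[_ pN].
apply: (dead_final gN (shortcut_net_reachable iM)) pN.
exact: shortcut_net_dead.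
Qed.

Let live_old u : u \in tr N -> u != t -> u != t' ->
  exists2 M, reachable N' M & enabled N' u M.
Proof.
move=> uN ut ut'; have [M iM uM] := live gN uN.
have [M' iM' MM'] := shortcut_net_simulates iM; exists M' => //.
apply: enabled_old; rewrite ?ut' ?orbT //.
case: MM' => [->//|[_ ->]]; split=> // p pu.
apply: leq_trans (uM.2 p pu) (fire_keep M _).
by apply/negP => pt; move: ut'; rewrite (single uN pt pu) eqxx.
Qed.

Let live' u : u \in tr N' -> exists2 M, reachable N' M & enabled N' u M.
Proof.
case/trN'P=> [->|[uN us ut k]].
  have [M iM tM] := live gN tN.
  have [M' iM' [e|[t'M _]]] := shortcut_net_simulates iM.
    by exists M' => //; rewrite e; apply: enabled_ts.
  (* The new net cannot be ahead here: with [t'] already enabled, firing [t] would violate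
     [safe]. *)
  have [p pt] := pre_ex gN t'N; have := safe p gN (fire_t_reachable iM tM).
  have npt : p \notin pre N t.
    by apply/negP => pt2; move: neq_tt'; rewrite (single tN pt pt2) eqxx.
  by rewrite /fire (pre_post pt) (negbTE npt); have := t'M.2 p pt; lia.
have [ut'|ut'] := eqVneq u t'; last exact: live_old.
(* A kept cluster has a feeder [v] other than [t], and [v] is live. After [v] fires, its token on
   [p] must be consumed before a dead marking is reached, and only [t'] can do so. *)
move: k; rewrite {}ut' {uN us ut u} eqxx orbF => /keptP[v [p [vN vt pt pv]]].
have vt' : v != t' by apply: contraTneq pv => ->; exact: pre_post'.
have [M iM vM] := live_old vN vt vt'.
have vs := neq_ts vN.
have iM1 : reachable N' (fire N' v M) by apply: star_rcons iM _; exists v.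
have M1p : 0 < fire N' v M p by apply: fire_post; rewrite post_old.
have pN' := reachable_pl rN' iM1 M1p.
have [M2 M12 dM2] := reach_dead (fire N' v M) rN'.
have [|M3 [w [M13 wM pw]]] := token_consumed M12 M1p.
  rewrite (dead_final' (star_trans iM1 M12) dM2 pN') /final_marking.
  by case: eqP pt => // -> pt; move: (po_pre gN t'N); rewrite pt.
exists M3; first exact: star_trans M13.
move: pw; rewrite pre_orig => pw; have := single (orig_tr wM.1) pt pw.
rewrite /orig; case: eqP => [_ e|_ <- //].
by move: neq_tt'; rewrite e eqxx.
Qed.

Lemma shortcut_net_good : good N'.
Proof.
split=> // p pN' np; have pN : p \in pl N by move: pN'; rewrite in_plN' => /andP[].
have [pt|npt] := boolP (p \in pre N t').
  have k : kept by move: pN'; rewrite in_plN' pt orbF => /andP[].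
  have t'N' : t' \in tr N' by rewrite in_trN' k t'N (eq_sym t' t) neq_tt' orbT.
  (* Some reachable marking enables [t'] and thus marks [p]; a place other than [pi N] gets marked
     only by an input transition. *)
  have [M iM [_ pM]] := live' t'N'.
  have [|e|//] := reachable_marked iM (p := p); last by rewrite e eqxx in np.
  by apply: pM; rewrite pre_orig /orig (negbTE (neq_ts t'N)).
have [v vN pv] := in_ex gN pN np.
have [vt|vt] := eqVneq v t.
  by exists ts => //; rewrite mem_post_ts npt -vt pv.
have [vt'|vt'] := eqVneq v t'.
  by exists ts => //; rewrite mem_post_ts -vt' pv orbT.
exists v; first by rewrite in_trN' vt vt' vN !orbT.
by rewrite post_old ?neq_ts.
Qed.

(** Passing from [t] to [ts] trades the inputs of [t'] for its outputs, which weigh less. *)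
Let wt_post_ts : wt (post N' ts) < wt (post N t).
Proof.
suff : wt (post N' ts) + wt (pre N t') <= wt (post N t) + wt (post N t').
  by have := wt_post_lt_pre gN t'N; lia.
rewrite !wtE -!big_split /=; apply: leq_sum => p _.
rewrite -!mulnDl leq_mul2r mem_post_ts; apply/orP; right.
have := @pre_post p.
by case: (p \in pre N t'); case: (p \in post N t); case: (p \in post N t') => // /(_ isT).
Qed.

Lemma shortcut_net_nwt : nwt N' < nwt N.
Proof.
have nf : ts \notin [seq u <- tr N | (u != t) && (kept || (u != t'))].
  by rewrite mem_filter (negbTE (fresh_notin N)) andbF.
rewrite /nwt /= (negbTE nf) big_cons -filter_undup big_filter.
rewrite (sum_undupD1 (P := xpredT) _ tN) //= -addSn.
apply: leq_add; first by rewrite !ltnS wt_post_ts.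
rewrite [leqRHS](bigID (fun u => kept || (u != t'))) /=.
apply: leq_trans (leq_addr _ _); apply: eq_leq.
rewrite big_seq_cond [RHS]big_seq_cond; apply: eq_bigr => u.
by rewrite mem_undup => /andP[/neq_ts us _]; rewrite post_old.
Qed.

End Shortcut.

(** * Exhaustive reduction *)

Lemma good_reduces N : good N -> exists N', [/\ star (@rule_step col) N N', good N',
  trivial N', pi N' = pi N & po N' = po N].
Proof.
have [n] := ubnP (nwt N); elim: n N => // n IH N ltn gN.
have step N1 : rule_step N N1 -> good N1 -> nwt N1 < nwt N -> pi N1 = pi N -> po N1 = po N ->
    exists N', [/\ star (@rule_step col) N N', good N', trivial N', pi N' = pi N & po N' = po N].
  move=> NN1 gN1 lt <- <-; have [|N' [N1N' ? ? ? ?]] := IH N1 _ gN1; first by lia.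
  by exists N'; split=> //; apply: star_step NN1 N1N'.
have [[t [u mg]]|nm] := EM (exists t u, mergeable N t u).
  apply: (step (merge_net N t u)) => //.
  - by left; apply: merge_net_step.
  - exact: merge_net_good.
  - exact: merge_net_nwt.
have [[t [u sc]]|ns] := EM (exists t u, shortcutable N t u).
  apply: (step (shortcut_net N t u)) => //.
  - by right; apply: shortcut_net_step.
  - exact: shortcut_net_good.
  - exact: shortcut_net_nwt.
exists N; split=> //; first exact: star_refl.
apply: irreducible_trivial => // t u H; [apply: nm|apply: ns]; by exists t, u.
Qed.

End Ranked.

(** * From acyclic workflow nets to ranked nets *)

Section Acyclic.

Variables (col : nat -> Type) (W : net col).
Hypotheses (cwfW : is_cwf W) (soundW : sound W) (acyclicW : acyclic W).
Hypothesis fcW : free_choice W.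

Definition depth p :=
  count (fun q => `[< plus (arcF W) (inl p) (inl q) >]) (undup (pl W)).

(** Every place beyond [q] is beyond [p], and [q] is beyond [p] but, by acyclicity, not beyond
    itself. *)
Lemma depth_lt t p q : t \in tr W -> p \in pl W -> q \in pl W ->
  p \in pre W t -> q \in post W t -> depth q < depth p.
Proof.
move=> tW pW qW pt qt; pose P r x := `[< plus (arcF W) (inl r) (inl x) >].
have pq : plus (arcF W) (inl p) (inl q).
  exists (inr t) => //.
  by apply: star_step (star_refl _ _).
have c1 : count (pred1 q) (undup (pl W)) = 1.
  by rewrite count_uniq_mem ?undup_uniq // mem_undup qW.
rewrite -addn1 -c1 /depth -/(P q) -/(P p).
rewrite -count_predUI (_ : count (predI _ _) _ = 0) ?addn0.
  apply: sub_count => x /= /orP[/asboolP[z qz zx]|/eqP->]; apply/asboolP => //.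
  case: pq => y py yq; exists y => //; apply: star_trans yq _.
  exact: star_step qz zx.
apply/eqP; rewrite -leqn0 leqNgt -has_count; apply/hasPn => x _ /=.
by apply/negP => /andP[/asboolP + /eqP e]; rewrite e; apply: acyclicW.
Qed.

Lemma acyclic_good : good depth (pl W) W.
Proof.
have [[[piW poW neq] sub pi_post po_pre conn] totalW] := cwfW.
have [complete liveW] := soundW.
(* A path from [pi W] to [x] ends with an arc into [x], and the extra arc of the strongly connected
   graph enters only [pi W]. *)
have last_arc x : in_net W x -> x <> inl (pi W) -> exists y, arcF W y x.
  move=> xW nx; have [e|[y _ [a|[_ e]]]] := star_last (conn (inl (pi W)) x piW xW).
  - by case: nx.
  - by exists y.
  - by case: nx.
have first_arc x : in_net W x -> x <> inl (po W) -> exists y, arcF W x y.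
  move=> xW nx; have [//|[y [a|[e _]] _]] := star_first (conn x (inl (po W)) xW poW).
    by exists y.
  by case: nx.
split; first split=> //.
- by move=> t /sub[].
- by move=> t /sub[].
- by move=> t tW; have [//|[p [_ _ pt]|//]] := last_arc (inr t) tW; exists p.
- by move=> t tW; have [//|[p [_ _ pt]|//]] := first_arc (inr t) tW; exists p.
- move=> p pW /eqP np; have [|[//|t [_ tW pt]]] := first_arc (inl p) pW.
    by case.
  by exists t.
- move=> t p q tW pt qt; have [preW postW] := sub t tW.
  by apply: (depth_lt tW) => //; [apply: preW|apply: postW].
- move=> t u p tW uW pt pu q; have [preT _] := sub t tW; have [preU _] := sub u uW.
  apply/idP/idP => qx.
    have [H|H] := fcW (preT p pt) (preT q qx); first by case: (H t tW).
    exact/(H u uW).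
  have [H|H] := fcW (preT p pt) (preU q qx); first by case: (H u uW).
  exact/(H t tW).
- move=> p pW /eqP np; have [|[//|t [tW _ pt]]] := last_arc (inl p) pW.
    by case.
  by exists t.
(* From a dead marking the run to the final marking promised by soundness must be empty. *)
- move=> M iM dM; have [M' MM' fM'] := complete M iM.
  by have [->//|[z [t tM _] _]] := star_first MM'; case: (dM t).
- exact: liveW.
Qed.

End Acyclic.

Theorem theorem2 (col : nat -> Type) (W : net col) :
  is_cwf W -> sound W -> acyclic W -> free_choice W ->
  exists W' : net col,
    [/\ star (@rule_step col) W W',
        is_cwf W',
        (forall p, p \in pl W' <-> p = pi W \/ p = po W) &
        exists t, [/\ forall u, u \in tr W' <-> u = t,
                      forall p, p \in pre W' t <-> p = pi W &
                      forall p, p \in post W' t <-> p = po W]].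
Proof.
move=> cwfW soundW acyclicW fcW.
have gW := acyclic_good cwfW soundW acyclicW fcW.
have [W' [WW' gW' [t [trE preE postE plE]] <- <-]] := good_reduces gW.
exists W'; split=> //; last by exists t.
split; last exact: (total gW').
have tW' : t \in tr W' by apply/trE.
split.
- by split; [exact: (pi_pl gW')|exact: (po_pl gW')|exact: (pi_neq_po gW')].
- by move=> u uW'; split; [exact: (pre_sub gW' uW')|exact: (post_sub gW' uW')].
- by move=> u uW'; exact: (pi_post gW' uW').
- by move=> u uW'; exact: (po_pre gW' uW').
(* With the extra arc, [pi W'], [t] and [po W'] form a cycle through all nodes. *)
pose R := fun u v => arcF W' u v \/ u = inl (po W') /\ v = inl (pi W').
have it : R (inl (pi W')) (inr t).
  by left; split=> //; [exact: (pi_pl gW')|apply/preE].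
have to : R (inr t) (inl (po W')).
  by left; split=> //; [exact: (po_pl gW')|apply/postE].
have oi : R (inl (po W')) (inl (pi W')) by right.
have from_i y : in_net W' y -> star R (inl (pi W')) y.
  case: y => [p /plE[->|->]|u /trE->]; first exact: star_refl.
    exact: star_step it (star_step to (star_refl _ _)).
  exact: star_step it (star_refl _ _).
have to_i x : in_net W' x -> star R x (inl (pi W')).
  case: x => [p /plE[->|->]|u /trE->]; first exact: star_refl.
    exact: star_step oi (star_refl _ _).
  exact: star_step to (star_step oi (star_refl _ _)).
by move=> x y /to_i xi /from_i iy; apply: star_trans xi iy.
Qed.
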